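(* Fix integers $h\ge 2$ and $g\ge 1$. Let $k=k(n)\in[0,n]$ be arbitrary and let $\mathcal{C}\subseteq[n]$ be a random subset in which each element of $[n]$ is included independently with probability $p=k/n$. Then, as $n\to\infty$, \[ k=o\!\left(n^{\frac{g}{h(g+1)}}\right)\Rightarrow \mathbb{P}(\mathcal{C}\text{ is } B_h[g])\to 1, \] and \[ n^{\frac{g}{h(g+1)}}=o(k)\Rightarrow \mathbb{P}(\mathcal{C}\text{ is } B_h[g])\to 0. \]
   Context: For $h\ge 2$, $g\ge 1$, a set $\mathcal{A}\subseteq[n]$ has the $B_h[g]$ property if for every integer $m\in[h,nh]$ the equation $a_1+a_2+\dots+a_h=m$ with $a_1\le a_2\le\dots\le a_h$ and all $a_i\in\mathcal{A}$ has at most $g$ solutions. *)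

(* Defs.v *)
From HB Require Import structures.
From mathcomp Require Import all_boot all_order all_algebra.
From mathcomp Require Import all_classical all_reals all_analysis.

Set Implicit Arguments.
Unset Strict Implicit.
Unset Printing Implicit Defensive.

Import Order.TTheory GRing.Theory Num.Theory.
Import numFieldNormedType.Exports.

Local Open Scope classical_set_scope.
Local Open Scope ring_scope.

(* The ordinal i : 'I_n stands for the element i + 1 of [n] = {1, ..., n}. *)
Definition elt (n : nat) (i : 'I_n) : nat := i.+1.

(* Weakly increasing h-tuples of elements of A with sum m. *)
Definition solutions (h n : nat) (A : {set 'I_n}) (m : nat) :
    {set h.-tuple 'I_n} :=
  [set a : h.-tuple 'I_n |
    [&& sorted leq (map (@elt n) a), all (fun i => i \in A) a
      & \sum_(i <- a) elt i == m]%N]%SET.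

Definition is_Bhg (h g n : nat) (A : {set 'I_n}) : Prop :=
  forall m : nat, (h <= m <= n * h)%N -> (#|solutions h A m| <= g)%N.

Definition mutually_independent (d : measure_display) (T : measurableType d)
    (R : realType) (P : probability T R) (I : finType) (E : I -> set T) : Prop :=
  forall J : {set I},
    P (\bigcap_(i in [set` J]) E i) = (\prod_(i in J) P (E i))%E.

Definition random_subset (d : measure_display) (T : measurableType d)
    (R : realType) (P : probability T R) (n : nat) (p : R)
    (C : T -> {set 'I_n}) : Prop :=
  [/\ forall i : 'I_n, measurable [set t | i \in C t],
      forall i : 'I_n, P [set t | i \in C t] = p%:E
    & mutually_independent P (fun i : 'I_n => [set t | i \in C t])].

(* Main.v *)
Require Import Defs.
From HB Require Import structures.
From mathcomp Require Import all_boot all_order all_algebra.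
From mathcomp Require Import zify ring lra.

(** First moment. If [C] is not [B_h[g]], pick [g + 1] solutions with a common
    sum, seen as vectors of multiplicities. Some [t >= 2] of them are linearly
    independent and use at most [r] distinct elements in all, where
    [r g <= (t - 1) h (g + 1)]: either all [g + 1] of them have a private element
    (then [t = g + 1]), or one takes a minimal family whose support covers a
    further solution; the positive and negative parts of a linear dependency
    cover each other, so minimality forbids dependencies. For each of the finitely
    many shapes there are [O(n^(r - t + 1))] choices of the [r] elements, whence an
    expected number [O(k^r n^(1 - t))], which tends to 0 below the threshold.

    Second moment. Split [n] into disjoint intervals, one for each position
    [(j, a)], [0 <= j <= g], [1 <= a <= h], so that every block [j] has exactly
    [L^(h - 1)] choices with sum [const + m] for each [m < L], where [L] is of order
    [n]. Two configurations meet only in equal positions, hence the second moment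
    factors over blocks and equals
    [p^(2 h (g + 1)) \sum_(m, m') W(m, m')^(g + 1)], with
    [W(m, m') <= L^(2 (h - 1)) (1 + 2^h / (L p) + [m = m'] L / (L p)^h)].
    Above the threshold it is asymptotic to the square of the mean, and
    Chebyshev's inequality applies. *)

Set Implicit Arguments.
Unset Strict Implicit.
Unset Printing Implicit Defensive.

Import Order.TTheory GRing.Theory Num.Theory.
Local Open Scope ring_scope.

(** * Counting configurations with more than [g] equal sums *)

Lemma card_determined (I J : finType) (D : {set I}) (S : {set {ffun I -> J}}) :
    (forall x y, x \in S -> y \in S -> {in D, x =1 y} -> x = y) ->
  (#|S| <= #|J| ^ #|D|)%N.
Proof.
move=> det.
pose res (x : {ffun I -> J}) : {ffun {i | i \in D} -> J} :=
  [ffun i => x (val i)].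
have inj : {in S &, injective res}.
  move=> x y xS yS /ffunP e; apply: det => // i iD.
  by have := e (exist _ i iD); rewrite !ffunE.
by rewrite -(card_in_imset inj) (leq_trans (max_card _)) // card_ffun card_sig.
Qed.

(** Full row rank gives [t] pivot columns forming an invertible minor; the coordinates off the
    pivots then determine a solution. *)
Lemma card_linear_system (F : fieldType) (t r : nat) (J : finType)
    (V : 'M[F]_(t, r)) (f : J -> F) (b : 'cV[F]_t) :
    injective f -> row_free V ->
  (#|[set x : {ffun 'I_r -> J} | V *m (\col_c f (x c)) == b]|
     <= #|J| ^ (r - t))%N.
Proof.
move=> finj Vfree.
have VTfull : row_full V^T by rewrite /row_full mxrank_tr.
pose e := fullrankfun VTfull.
have einj : injective e by exact: fullrankfun_inj.
have -> : (r - t)%N = #|~: [set e j | j : 'I_t]|.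
  by rewrite cardsCs setCK card_imset // !card_ord.
apply: card_determined => x y; rewrite !inE => /eqP Vx /eqP Vy exy.
pose z : 'rV[F]_r := \row_c (f (x c) - f (y c)).
have z0 c : c \notin [set e j | j : 'I_t] -> z 0 c = 0.
  by move=> cD; rewrite mxE exy ?subrr // inE.
have zV : z *m V^T = 0.
  rewrite -[z]trmxK -trmx_mul.
  have -> : z^T = \col_c f (x c) - \col_c f (y c).
    by apply/matrixP => i j; rewrite !mxE.
  by rewrite mulmxBr Vx Vy subrr trmx0.
have zE : (\row_j z 0 (e j)) *m rowsub e V^T = 0.
  rewrite -zV; apply/rowP => i; rewrite !mxE.
  rewrite [RHS](bigID (mem [set e j | j : 'I_t])) /= [X in _ + X]big1 ?addr0.
    rewrite big_imset /=; last by move=> ? ? _ _ /einj.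
    by apply: eq_big => [j|j _]; rewrite ?inE // !mxE.
  by move=> c /z0 ->; rewrite mul0r.
have U := fullrowsub_unit VTfull.
have {zE}ze : \row_j z 0 (e j) = 0.
  by rewrite -[LHS](mulmxK U) zE mul0mx.
apply/ffunP => c; apply: finj; apply/eqP; rewrite -subr_eq0.
have [/imsetP [j _ ->]|/z0] := boolP (c \in [set e j | j : 'I_t]).
  by have /rowP/(_ j) := ze; rewrite !mxE => ->.
by rewrite mxE => ->.
Qed.

(** * Linearly independent subfamilies with small support *)

Section Independence.
Variables (T I : finType) (v : T -> I -> nat).

Definition supp (s : T) : {set I} := [set i | 0 < v s i]%N.

Definition suppU (S : {set T}) : {set I} := \bigcup_(s in S) supp s.

Definition lin_indep (S : {set T}) : Prop :=
  forall c : T -> rat,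
    (forall i, \sum_(s in S) c s * (v s i)%:R = 0) -> {in S, forall s, c s = 0}.

Lemma card_supp (s : T) : (#|supp s| <= \sum_i v s i)%N.
Proof.
rewrite -sum1_card big_mkcond; apply: leq_sum => i _.
by rewrite inE; case: ltnP.
Qed.

Lemma card_suppU (h : nat) (S : {set T}) :
    {in S, forall s, (\sum_i v s i)%N = h} ->
  (#|suppU S| <= #|S| * h)%N.
Proof.
move=> vh; rewrite /suppU -sum_nat_const.
apply: (@leq_trans (\sum_(s in S) #|supp s|)%N).
  elim/big_rec2: _ => [|s m U _ IH]; first by rewrite cards0.
  by rewrite (leq_trans (leq_card_setU _ _)) // leq_add2l.
by apply: leq_sum => s sS; rewrite -(vh s sS) card_supp.
Qed.

(* The coordinate of [s] at [i] can only be cancelled by a positive term. *)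
Lemma dependency_cover (S : {set T}) (c : T -> rat) (s : T) (i : I) :
    (forall i, \sum_(s in S) c s * (v s i)%:R = 0) ->
    s \in S -> c s < 0 -> (0 < v s i)%N ->
  exists2 s', s' \in [set s' in S | 0 < c s'] & i \in supp s'.
Proof.
move=> c0 sS cs vsi.
apply/exists_inP; apply: contraTT isT => /exists_inPn H.
have := c0 i; rewrite (bigD1 s) //= => E.
suff : c s * (v s i)%:R + \sum_(j in S | j != s) c j * (v j i)%:R < 0.
  by rewrite E ltxx.
rewrite -(addr0 0) ltr_leD ?pmulr_llt0 ?ltr0n // sumr_le0 // => j /andP [jS _].
have [cj|cj] := ltP 0 (c j); last by rewrite mulr_le0_ge0.
have := H j; rewrite !inE jS cj => /(_ isT).
by rewrite lt0n negbK => /eqP ->; rewrite mulr0.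
Qed.

(** If no subfamily covers a further member, [S] itself is independent. Otherwise a smallest cover
    [U] of some [s] gives [s |: U], with [t = #|U| + 1] and the same support as [U], hence at most
    [(t - 1) h] elements. *)
Lemma independent_subfamily (h g : nat) (S : {set T}) :
    (0 < h)%N -> (0 < g)%N -> #|S| = g.+1 ->
    {in S, forall s, (\sum_i v s i)%N = h} ->
    {in S &, forall s s', v s =1 v s' -> s = s'} ->
  exists S' : {set T},
    [/\ S' \subset S, (1 < #|S'|)%N, lin_indep S'
      & (#|suppU S'| * g <= #|S'|.-1 * h * g.+1)%N].
Proof.
move=> h0 g0 cS vh vinj.
pose cov (T' : {set T}) s :=
  [&& T' \subset S, T' != set0, s \in S, s \notin T' & supp s \subset suppU T'].
have covP (U : {set T}) (c : T -> rat) s : U \subset S ->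
    (forall i, \sum_(s in U) c s * (v s i)%:R = 0) -> s \in U -> c s < 0 ->
    cov [set s' in U | 0 < c s'] s.
  move=> US c0 sU cs; have H i := @dependency_cover U c s i c0 sU cs.
  have sS := subsetP US _ sU.
  (* As [h > 0], [s] has a positive coordinate, and its cancellation makes the positive part
     nonempty. *)
  have [i vi] : exists i, (0 < v s i)%N.
    apply/existsP; apply: contraTT h0 => /existsPn vs0.
    by rewrite -(vh s sS) big1 // => i _; apply/eqP; rewrite -leqn0 leqNgt.
  apply/and5P; split=> //.
  - by apply: subset_trans US; apply/subsetP => x; rewrite inE => /andP [].
  - by have [s' s'P _] := H i vi; apply/set0Pn; exists s'.
  - by rewrite inE sU /= -leNgt ltW.
  - apply/subsetP => j; rewrite inE => vj.
    by have [s' s'P js'] := H j vj; apply/bigcupP; exists s'.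
(* A nontrivial dependency has both signs; [covP] for [c] and [- c] makes each signed part cover a
   member of the other. *)
have dep (U : {set T}) (c : T -> rat) : U \subset S ->
    (forall i, \sum_(s in U) c s * (v s i)%:R = 0) ->
    {in U, forall s, c s = 0} \/
    (exists a b, cov [set s in U | 0 < c s] a /\ cov [set s in U | c s < 0] b).
  move=> US c0.
  have c0' i : \sum_(s in U) - c s * (v s i)%:R = 0.
    transitivity (- (\sum_(s in U) c s * (v s i)%:R)); last by rewrite c0 oppr0.
    by rewrite -sumrN; apply: eq_bigr => s _; rewrite mulNr.
  have E : [set s' in U | 0 < - c s'] = [set s in U | c s < 0].
    by apply/setP => s; rewrite !inE oppr_gt0.
  have pos s : s \in U -> 0 < c s -> cov [set s in U | c s < 0] s.
    move=> sU cs; rewrite -E.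
    by apply: (covP U (fun s => - c s)); rewrite ?oppr_lt0.
  have [/forall_inP H|/forall_inPn [s sU cs]] := boolP [forall s in U, c s == 0].
    by left=> s /H /eqP.
  right; have [neg|] := ltP (c s) 0.
    have cvs := covP U c s US c0 sU neg.
    have /and5P [_ /set0Pn [b]] := cvs; rewrite inE => /andP [bU cb] _ _ _.
    by exists s, b; split=> //; apply: pos.
  rewrite le_eqVlt eq_sym (negPf cs) /= => /(pos _ sU) cvs.
  have /and5P [_ /set0Pn [b]] := cvs; rewrite inE => /andP [bU cb] _ _ _.
  by exists b, s; split=> //; apply: covP.
pose Q k := [exists U, [exists s, cov U s && (#|U| == k)]].
have [/existsP [k0 Qk0]|noQ] :=
    boolP [exists k : 'I_#|T|.+1, Q k]; last first.
  have nocov U s : ~~ cov U s.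
    apply: contra noQ => cv; have lt : (#|U| < #|T|.+1)%N by rewrite ltnS max_card.
    by apply/existsP; exists (Ordinal lt); apply/existsP; exists U;
       apply/existsP; exists s; rewrite cv /=.
  exists S; rewrite cS; split=> //.
    move=> c /(dep _ _ (subxx _)) [//|[a [b [/(negP (nocov _ _))]]]] //.
  by rewrite /= mulnC -mulnA leq_mul2l [(h * _)%N]mulnC -cS card_suppU ?orbT.
have exQ : exists k, Q k by exists (nat_of_ord k0).
case: (ex_minnP exQ) => k /existsP [U /existsP [s /andP [cv /eqP cU]]] kmin.
have kle U' s' : cov U' s' -> (k <= #|U'|)%N.
  by move=> cv'; apply: kmin; apply/existsP; exists U'; apply/existsP; exists s';
     rewrite cv' /=.
have /and5P [US U0 sS sU sup] := cv.
have kpos : (0 < k)%N by rewrite -cU card_gt0.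
have cUs : #|s |: U| = k.+1 by rewrite cardsU1 sU cU.
have UsS : s |: U \subset S.
  by apply/subsetP => x; rewrite !inE => /orP [/eqP ->|/(subsetP US)].
exists (s |: U); rewrite cUs; split=> //; last first.
  rewrite /suppU big_setU1 //= -/(suppU U).
  have -> : supp s :|: suppU U = suppU U by apply/setUidPr.
  rewrite -cU leq_mul ?card_suppU // => x /(subsetP US); exact: vh.
move=> c c0; have [//|[a [b [cva cvb]]]] := dep _ c UsS c0.
(* Both signed parts are at least as large as the minimal cover [U], so [k = 1]. *)
set Po := [set s0 in _ | 0 < c s0] in cva; set Ne := [set s0 in _ | _ < 0] in cvb.
have PN : (#|Po| + #|Ne| <= k.+1)%N.
  rewrite -cUs -cardsUI; have -> : Po :&: Ne = set0.
    apply/setP => x; rewrite !inE; apply/negP => /andP [/andP [_ p] /andP [_ q]].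
    by have := lt_trans p q; rewrite ltxx.
  rewrite cards0 addn0 subset_leq_card //; apply/subsetP => x.
  by rewrite inE => /orP []; rewrite inE => /andP [].
have kP := kle _ _ cva; have kN := kle _ _ cvb.
have k1 : k = 1%N by lia.
have /eqP/cards1P [x Ux] : #|U| = 1%N by rewrite cU.
have sx : s != x by move: sU; rewrite Ux inE.
(* Two proportional vectors with the same coordinate sum [h > 0] are equal, against [vinj], unless
   both coefficients vanish. *)
have c2 i : c s * (v s i)%:R + c x * (v x i)%:R = 0.
  by rewrite -(c0 i) Ux big_setU1 ?inE //= big_set1.
have xS : x \in S by apply: (subsetP US); rewrite Ux inE.
have csum : c s + c x = 0.
  have : \sum_i (c s * (v s i)%:R + c x * (v x i)%:R) = 0 by rewrite big1.
  rewrite big_split /= -!mulr_sumr -!natr_sum !vh // -mulrDl => /eqP.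
  by rewrite mulf_eq0 pnatr_eq0 (gtn_eqF h0) orbF => /eqP.
have [cs0|cs0] := eqVneq (c s) 0.
  move: csum; rewrite cs0 add0r => cx0 y.
  by rewrite Ux !inE => /orP [] /eqP ->.
case/negP: sx; apply/eqP; apply: vinj => // i.
apply/eqP; rewrite -(eqr_nat rat) -subr_eq0; apply/eqP/(mulfI cs0).
by rewrite mulr0 mulrBr -[RHS](c2 i) -[c x](addKr (c s)) csum addr0 mulNr.
Qed.

End Independence.

(** * From a violation to a finite pattern *)

Lemma sum_count_mem (T : finType) (F : T -> nat) (s : seq T) :
  (\sum_i count_mem i s * F i = \sum_(j <- s) F j)%N.
Proof.
elim: s => [|x s IH]; first by rewrite big_nil big1.
rewrite big_cons -IH /= [in RHS](bigD1 x) //= [in LHS](bigD1 x) //= eqxx.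
rewrite mulnDl mul1n addnA; congr addn.
by apply: eq_bigr => i ix; rewrite eq_sym (negPf ix).
Qed.

Lemma solution_inj (h n m : nat) (A : {set 'I_n}) :
  {in solutions h A m &, forall a b : h.-tuple 'I_n,
    (fun i => count_mem i a) =1 (fun i => count_mem i b) -> a = b}.
Proof.
move=> a b; rewrite !inE => /and3P [sa _ _] /and3P [sb _ _] ab.
have elt_inj : injective (@elt n) by move=> x y [] /val_inj.
apply/val_inj/(inj_map elt_inj)/(sorted_eq leq_trans anti_leq sa sb).
by apply/perm_map/allP => x _; apply/eqP/ab.
Qed.

(* Row [i] holds the multiplicities of the [r] elements in the [i]-th solution. *)
Definition pattern_mx (h t r : nat) (w : 'M['I_h.+1]_(t, r)) : 'M[rat]_(t, r) :=
  \matrix_(i, j) (w i j : nat)%:R.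

(** Entries in ['I_h.+1] make the number of shapes independent of [n]; full row rank is included
    because the count of the [x] for given [w] and [m] rests on it. *)
Definition realization (h t r n : nat) (w : 'M['I_h.+1]_(t, r)) (m : nat)
    (x : {ffun 'I_r -> 'I_n}) : bool :=
  [&& row_free (pattern_mx w), injectiveb x
    & pattern_mx w *m (\col_c (elt (x c))%:R) == const_mx m%:R].

(* The inequality [t - 1 >= r g / (h (g + 1))], in natural numbers. *)
Definition admissible (h g t r : nat) : bool :=
  [&& 1 < t, t <= r & r * g <= t.-1 * h * g.+1]%N.

(** The solutions kept by [independent_subfamily] become rows and the elements of their joint
    support columns, both numbered by [enum_val]. *)
Lemma pattern_of_not_Bhg (h g n : nat) (A : {set 'I_n}) :
    (0 < h)%N -> (0 < g)%N -> ~ is_Bhg h g A ->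
  exists (t : 'I_g.+2) (r : 'I_(g.+1 * h).+1),
    admissible h g t r /\
    exists (z : 'M['I_h.+1]_(t, r) * 'I_(n * h).+1 * {ffun 'I_r -> 'I_n}),
      realization z.1.1 z.1.2 z.2 && [forall c, z.2 c \in A].
Proof.
move=> h0 g0 notB.
have [/forallP H|/forallPn [m]] := boolP [forall m : 'I_(n * h).+1,
    (h <= m <= n * h)%N ==> (#|solutions h A m| <= g)%N].
  case: notB => m /[dup] mh /andP [_ mn].
  have lt : (m < (n * h).+1)%N by [].
  by have /implyP := H (Ordinal lt); apply.
rewrite negb_imply -ltnNge => /andP [_].
rewrite -[(g < _)%N]/(g.+1 <= _)%N => /card_geqP [s [us ss sub]].
pose S : {set h.-tuple 'I_n} := [set a in s].
have Ssub a : a \in S -> a \in solutions h A m by rewrite inE; apply: sub.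
pose v (a : h.-tuple 'I_n) (i : 'I_n) := count_mem i a.
have cS : #|S| = g.+1 by rewrite cardsE (card_uniqP us).
have vh a : (\sum_i v a i)%N = h.
  rewrite -[RHS](size_tuple a) -sum1_size -[RHS]sum_count_mem.
  by apply: eq_bigr => i _; rewrite muln1.
have vinj : {in S &, forall a b, v a =1 v b -> a = b}.
  by move=> a b /Ssub aS /Ssub bS; apply: solution_inj aS bS.
have [S' [S'S S'1 indep S'card]] :=
  independent_subfamily h0 g0 cS (fun a _ => vh a) vinj.
set U := suppU v S' in S'card.
have tlt : (#|S'| < g.+2)%N by rewrite ltnS -cS subset_leq_card.
have rle : (#|U| <= #|S'| * h)%N by apply: card_suppU => a _; exact: vh.
have rlt : (#|U| < (g.+1 * h).+1)%N.
  by rewrite ltnS (leq_trans rle) // leq_mul2r -ltnS tlt orbT.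
have [a0 a0S] : exists a, a \in S' by apply/set0Pn; rewrite -card_gt0 ltnW.
(* [inord] never falls back to its default: multiplicities in a tuple of length [h] are at most
   [h]. *)
pose w : 'M['I_h.+1]_(#|S'|, #|U|) :=
  \matrix_(i, c) inord (v (enum_val i) (enum_val c)).
have wE i c : (w i c : nat) = v (enum_val i) (enum_val c).
  rewrite mxE inordK // ltnS -[leqRHS](size_tuple (enum_val i)); exact: count_size.
have v0 a i : a \in S' -> i \notin U -> v a i = 0%N.
  move=> aS; apply: contraNeq => vai; apply/bigcupP; exists a => //.
  by rewrite inE lt0n.
have Vfree : row_free (pattern_mx w).
  apply: inj_row_free => u uV; apply/rowP => j; rewrite [RHS]mxE.
  pose c (a : h.-tuple 'I_n) := u 0 (enum_rank_in a0S a).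
  have cE k : c (enum_val k) = u 0 k by rewrite /c enum_valK_in.
  rewrite -cE; apply: indep (enum_valP j) => i.
  have [iU|iU] := boolP (i \in U); last first.
    by rewrite big1 // => a aS; rewrite v0 ?mulr0.
  have /rowP/(_ (enum_rank_in iU i)) := uV.
  rewrite !mxE => E; rewrite -[RHS]E [LHS]big_enum_val /=.
  by apply: eq_bigr => k _; rewrite mxE wE enum_rankK_in // cE.
exists (Ordinal tlt), (Ordinal rlt); split.
  (* Here [t <= r] because the rank [t] is at most the number of columns. *)
  by apply/and3P; split=> //=; rewrite -(eqP Vfree) rank_leq_col.
exists (w, m, [ffun c => enum_val c]) => /=; apply/andP; split; last first.
  apply/forallP => c; rewrite ffunE.
  have /bigcupP [a aS] := enum_valP c.
  rewrite inE -has_count => /hasP [y ya /eqP <-].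
  have := Ssub _ (subsetP S'S _ aS); rewrite inE => /and3P [_ /allP aA _].
  exact: aA.
apply/and3P; split.
- exact: Vfree.
- by apply/injectiveP => c c'; rewrite !ffunE => /enum_val_inj.
apply/eqP/matrixP => i j; rewrite !mxE.
have aS : enum_val i \in S' := enum_valP i.
have := Ssub _ (subsetP S'S _ aS); rewrite inE => /and3P [_ _ /eqP <-].
rewrite -sum_count_mem (bigID (mem U)) /= [X in (_ + X)%N]big1 ?addn0; last first.
  by move=> k kU; rewrite -/(v _ _) v0.
rewrite natr_sum [RHS]big_enum_val /=; apply: eq_bigr => c _.
by rewrite [pattern_mx w _ _]mxE wE mxE ffunE natrM.
Qed.

(** * First moment *)

Lemma union_bound (R : numDomainType) (T Z : finType) (mu : T -> R)
    (Q : pred T) (E : Z -> pred T) :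
    (forall A, 0 <= mu A) -> (forall A, Q A -> exists z, E z A) ->
  \sum_(A | Q A) mu A <= \sum_z \sum_(A | E z A) mu A.
Proof.
move=> mu0 QE.
rewrite (exchange_big_dep predT) //= [leRHS](bigID Q) /= -[leLHS]addr0.
apply: lerD; last by apply: sumr_ge0 => A _; apply: sumr_ge0.
apply: ler_sum => A /QE [z zA].
by rewrite (bigD1 z) //= lerDl sumr_ge0.
Qed.

(** The probability space is reduced to weights on finitely many subsets, known through inclusion
    probabilities; [U = set0] gives total mass 1. *)
Definition subset_law (R : numDomainType) (n : nat) (p : R)
    (mu : {set 'I_n} -> R) : Prop :=
  (forall A, 0 <= mu A) /\
  (forall U : {set 'I_n}, \sum_(A : {set 'I_n} | U \subset A) mu A = p ^+ #|U|).

(** A union bound over shapes, matrices, sums and realizations. A realization has probability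
    [p ^+ r], its elements being distinct, and by [card_linear_system] a matrix and a sum admit at
    most [n ^ (r - t)] of them. *)
Lemma not_Bhg_bound (R : numDomainType) (h g n : nat) (p : R)
    (mu : {set 'I_n} -> R) (Q : pred {set 'I_n}) :
    (0 < h)%N -> (0 < g)%N -> 0 <= p -> subset_law p mu ->
    (forall A, Q A -> ~ is_Bhg h g A) ->
  \sum_(A | Q A) mu A <=
    \sum_(t < g.+2) \sum_(r < (g.+1 * h).+1 | admissible h g t r)
      (#|{: 'M['I_h.+1]_(t, r)}| * (n * h).+1 * n ^ (r - t))%:R * p ^+ r.
Proof.
move=> h0 g0 p0 [mu0 muU] QB.
pose ev (t : 'I_g.+2) (r : 'I_(g.+1 * h).+1)
  (z : 'M['I_h.+1]_(t, r) * 'I_(n * h).+1 * {ffun 'I_r -> 'I_n}) :=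
  [pred A : {set 'I_n} | realization z.1.1 z.1.2 z.2 && [forall c, z.2 c \in A]].
pose E (tr : 'I_g.+2 * 'I_(g.+1 * h).+1) :=
  [pred A : {set 'I_n} | admissible h g tr.1 tr.2 && [exists z, ev tr.1 tr.2 z A]].
apply: (@le_trans _ _ (\sum_tr \sum_(A | E tr A) mu A)).
  apply: union_bound => // A /QB /(pattern_of_not_Bhg h0 g0) [t [r [tr [z Ez]]]].
  by exists (t, r); rewrite /= tr; apply/existsP; exists z.
rewrite -(pair_bigA _ (fun t r => \sum_(A | E (t, r) A) mu A)) /=.
apply: ler_sum => t _; rewrite [leRHS]big_mkcond; apply: ler_sum => r _.
case: ifP => tr; last by rewrite big_pred0.
apply: (@le_trans _ _ (\sum_z \sum_(A | ev t r z A) mu A)).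
  by apply: union_bound => // A /existsP.
have evE z : \sum_(A | ev t r z A) mu A =
    if realization z.1.1 z.1.2 z.2 then p ^+ r else 0.
  case: ifP => Rz; last by rewrite big_pred0 // => A; rewrite /= Rz.
  have /and3P [_ /injectiveP zinj _] := Rz.
  rewrite -[in RHS](card_ord r) -cardsT -(card_imset _ zinj) -muU.
  apply: eq_bigl => A; rewrite /= Rz /=; apply/forallP/subsetP.
    by move=> H y /imsetP [c _ ->].
  by move=> H c; apply/H/imset_f.
rewrite (eq_bigr _ (fun z _ => evE z)) -big_mkcond /= sumr_const.
rewrite -[X in X *+ _]mulr1 -mulrnAr mulrC ler_wpM2r ?exprn_ge0 // ler_nat.
rewrite -mulnA -sum1_card.
rewrite -(pair_big_dep predT
  (fun (wm : 'M['I_h.+1]_(t, r) * 'I_(n * h).+1) (x : {ffun 'I_r -> 'I_n}) =>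
    realization wm.1 wm.2 x) (fun _ _ => 1%N)) /=.
rewrite mulnA -[X in (_ * X * _)%N](card_ord (n * h).+1) -card_prod -sum_nat_const.
apply: leq_sum => [[w m]] _ /=; rewrite sum1dep_card.
have [Vfree|nVfree] := boolP (row_free (pattern_mx w)); last first.
  by rewrite eq_card0 // => x; rewrite !inE /realization (negPf nVfree).
rewrite -[X in (X ^ _)%N](card_ord n).
have finj : injective (fun i : 'I_n => (elt i)%:R : rat).
  by move=> i j /eqP; rewrite eqr_nat => /eqP [] /val_inj.
apply: leq_trans (card_linear_system (const_mx m%:R) finj Vfree).
by apply/subset_leq_card/subsetP => x; rewrite !inE => /and3P [].
Qed.

(** * A family of configurations for the second moment *)

(** Chebyshev: [N A] counts the [x] with [S x] inside [A] and has mean [e]. On [Q] it vanishes, so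
    its squared deviation there is [e ^+ 2]; the right-hand side is the variance. *)
Lemma second_moment (R : realFieldType) (n : nat) (p : R)
    (mu : {set 'I_n} -> R) (X : finType) (S : X -> {set 'I_n})
    (Q : pred {set 'I_n}) :
    subset_law p mu -> (forall A x, Q A -> ~~ (S x \subset A)) ->
  (\sum_(A | Q A) mu A) * (\sum_x p ^+ #|S x|) ^+ 2 <=
    \sum_x \sum_y p ^+ #|S x :|: S y| - (\sum_x p ^+ #|S x|) ^+ 2.
Proof.
move=> [mu0 muU] QS.
pose N (A : {set 'I_n}) : R := \sum_x (S x \subset A)%:R.
set e := \sum_x p ^+ #|S x|.
have mu1 : \sum_A mu A = 1.
  have := muU set0; rewrite cards0 expr0 => <-.
  by apply: eq_bigl => A; rewrite sub0set.
have muN (U : {set 'I_n}) : \sum_A mu A * (U \subset A)%:R = p ^+ #|U|.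
  by rewrite -muU [RHS]big_mkcond; apply: eq_bigr => A _; rewrite mulr_natr mulrb.
have E1 : \sum_A mu A * N A = e.
  under eq_bigr do rewrite mulr_sumr.
  by rewrite exchange_big; apply: eq_bigr => x _; rewrite muN.
have E2 : \sum_A mu A * N A ^+ 2 = \sum_x \sum_y p ^+ #|S x :|: S y|.
  under eq_bigr do rewrite expr2 mulr_suml mulr_sumr.
  rewrite exchange_big; apply: eq_bigr => x _.
  under eq_bigr do rewrite mulr_sumr mulr_sumr.
  rewrite exchange_big; apply: eq_bigr => y _; rewrite -muN.
  by apply: eq_bigr => A _; rewrite -natrM mulnb subUset.
rewrite -E2 mulr_suml.
apply: (@le_trans _ _ (\sum_A mu A * (N A - e) ^+ 2)).
  rewrite big_mkcond; apply: ler_sum => A _; case: ifP => QA.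
    rewrite [N A]big1 ?sub0r ?sqrrN // => x _.
    by rewrite (negPf (QS A x QA)).
  by rewrite mulr_ge0 ?sqr_ge0.
have -> : \sum_A mu A * (N A - e) ^+ 2 =
    \sum_A (mu A * N A ^+ 2 - (2 * e) * (mu A * N A) + e ^+ 2 * mu A).
  by apply: eq_bigr => A _; ring.
by rewrite !big_split /= sumrN -!mulr_sumr E1 mu1; lra.
Qed.

Lemma big_option (R : Type) (idx : R) (op : Monoid.com_law idx) (T : finType)
    (F : option T -> R) :
  \big[op/idx]_o F o = op (F None) (\big[op/idx]_t F (Some t)).
Proof.
rewrite (bigD1 None) //=; congr (op _ _).
rewrite (reindex_omap Some id); last by case.
by apply: eq_bigl => t /=; rewrite eqxx.
Qed.

(** Inclusion-exclusion: points are shared only at a common index, and each shared point saves one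
    factor [p]. The product form is what lets the second moment factor. *)
Lemma expr_card_union (R : fieldType) (I J : finType) (f f' : I -> J) (p : R) :
    p != 0 -> injective f -> injective f' ->
    (forall i i', f i = f' i' -> i = i') ->
  p ^+ #|[set f i | i : I] :|: [set f' i | i : I]| =
    p ^+ (2 * #|I|) * \prod_i (if f i == f' i then p^-1 else 1).
Proof.
move=> p0 finj f'inj ff'.
pose D := [set i | f i == f' i].
have -> : \prod_i (if f i == f' i then p^-1 else 1) = p^-1 ^+ #|D|.
  by rewrite -big_mkcond /= -prodr_const; apply: eq_bigl => i; rewrite inE.
have cD : #|[set f i | i : I] :&: [set f' i | i : I]| = #|D|.
  rewrite -(card_imset (mem D) finj); congr #|pred_of_set _|.
  apply/setP => y; rewrite inE; apply/andP/imsetP.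
    move=> [/imsetP [i _ yi] /imsetP [i' _ yi']].
    by exists i => //; rewrite inE {2}(ff' i i') -?yi ?yi'.
  move=> [i]; rewrite inE => /eqP fi ->.
  by rewrite imset_f // fi imset_f.
rewrite exprVn; apply: (canRL (mulfK _)); first exact: expf_neq0.
by rewrite -exprD -cD cardsUI !card_imset // addnn mul2n.
Qed.

(** * Configurations spread over disjoint intervals *)

Section Configurations.
Variables (h' g L n : nat).
Let B := (h'.+1 * L)%N.

(* [slot j o] is the index of the interval of length [B] hosting position [(j, o)];
   its values are distinct and their sum over [o] does not depend on [j]. The
   position [None] is the one determined by the target [m] and the free
   coordinates [u]; there, the subtraction in [offset] never truncates. *)
Definition slot (j : 'I_g.+1) (o : option 'I_h') : nat :=
  if o is Some a then a * g.+1 + j else h' * g.+1 + h' * (g - j).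

Definition offset (m : 'I_L) (u : {ffun 'I_h' -> 'I_L}) (o : option 'I_h') : nat :=
  if o is Some a then u a else h' * L + m - \sum_a u a.

Lemma slot_lt j o : (slot j o <= h' * (g.+1 + g))%N.
Proof.
case: o => [a|] /=; last by rewrite mulnDr leq_add2l leq_mul2l leq_subr orbT.
have := ltn_ord a; have := ltn_ord j; nia.
Qed.

Lemma sum_offset_le (u : {ffun 'I_h' -> 'I_L}) : (\sum_a u a <= h' * L)%N.
Proof.
rewrite -[X in (_ <= X * _)%N]card_ord -sum_nat_const.
by apply: leq_sum => a _; apply: ltnW.
Qed.

Lemma offset_lt m u o : (offset m u o < B)%N.
Proof.
case: o => [a|] /=; rewrite /B mulSn.
  by rewrite (leq_trans (ltn_ord _)) ?leq_addr.
by rewrite (leq_ltn_trans (leq_subr _ _)) // addnC ltn_add2r.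
Qed.

(** Agreement at [Some a] fixes [u' a]; agreement at [None] fixes the sum of [u'], hence one more
    coordinate if any is still open. If all positions agree, [u'] is determined and the sums force
    [m = m']. *)
Lemma card_agree (m m' : 'I_L) (u : {ffun 'I_h' -> 'I_L})
    (F : {set option 'I_h'}) :
  (#|[set u' | [set o | offset m u o == offset m' u' o] == F]| <=
    if F == setT then nat_of_bool (m == m') else L ^ (h' - #|F|))%N.
Proof.
pose K := [set u' | [set o | offset m u o == offset m' u' o] == F].
rewrite -/K.
have KP u' o : u' \in K -> (o \in F) = (offset m u o == offset m' u' o).
  by rewrite inE => /eqP <-; rewrite inE.
have Kfree u' a : u' \in K -> Some a \in F -> u' a = u a.
  by move=> /KP -> /eqP /= /val_inj.
(* By [sum_offset_le] no subtraction truncates, so equal last offsets give a linear relation. *)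
have Klast u' : u' \in K -> None \in F -> (m + \sum_a u' a = m' + \sum_a u a)%N.
  move=> /KP -> /eqP /=; have := sum_offset_le u; have := sum_offset_le u'.
  move: (\sum_a u a)%N (\sum_a u' a)%N (h' * L)%N (nat_of_ord m) => s s' k k'.
  lia.
case: eqP => [FT|/eqP FT].
  have [mm'|mm'] := eqVneq m m'.
    rewrite leqNgt; apply/negP => /card_gt1P [a [b [aK bK]]] /eqP; apply.
    by apply/ffunP => i; rewrite !(Kfree _ i) // FT inE.
  rewrite leqn0 cards_eq0; apply/eqP/setP => u'; rewrite in_set0.
  apply/negP => u'K; case/eqP: mm'; apply: val_inj => /=.
  have := Klast u' u'K; rewrite FT inE => /(_ isT).
  rewrite (eq_bigr (fun a => nat_of_ord (u a))) => [|a _]; last first.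
    by rewrite (Kfree u') // FT inE.
  by move/eqP; rewrite eqn_add2r => /eqP.
pose D := [set a | Some a \notin F].
have cD : (#|F| = (None \in F) + (h' - #|D|))%N.
  rewrite -sum1_card big_mkcond big_option /=; congr (_ + _)%N.
  have -> : (h' - #|D| = #|~: D|)%N by rewrite [RHS]cardsCs setCK card_ord.
  rewrite -big_mkcond /= -sum1_card.
  by apply: eq_bigl => a; rewrite !inE negbK.
have Dh : (#|D| <= h')%N by rewrite -[leqRHS]card_ord max_card.
have [lastF|lastF] := boolP (None \in F); last first.
  have -> : (h' - #|F| = #|D|)%N by rewrite cD (negPf lastF) add0n subKn.
  rewrite -[X in (X ^ _)%N](card_ord L); apply: card_determined => x y xK yK xy.
  apply/ffunP => a; have [aF|aF] := boolP (Some a \in F); last by rewrite xy ?inE.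
  by rewrite !(Kfree _ a).
have [a0 a0D] : exists a, a \in D.
  apply/existsP; apply: contraR FT => /existsPn H; apply/eqP/setP => o.
  rewrite inE; case: o => [a|] //.
  by have := H a; rewrite inE negbK.
have -> : (h' - #|F| = #|D :\ a0|)%N.
  by have := cardsD1 a0 D; rewrite cD lastF a0D; lia.
rewrite -[X in (X ^ _)%N](card_ord L); apply: card_determined => x y xK yK xy.
have eqa a : a != a0 -> x a = y a.
  move=> aa0; have [aF|aF] := boolP (Some a \in F); last by rewrite xy // !inE aa0.
  by rewrite !(Kfree _ a).
apply/ffunP => a; have [->|/eqa //] := eqVneq a a0.
have := Klast y yK lastF; rewrite -(Klast x xK lastF) => /eqP.
rewrite eqn_add2l [X in _ == X](bigD1 a0) //= [X in X == _](bigD1 a0) //=.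
rewrite [X in (_ + X == _)%N](eq_bigr (fun a => nat_of_ord (x a))); last first.
  by move=> i /eqa ->.
by rewrite eqn_add2r => /eqP /val_inj.
Qed.

Hypothesis Ln : ((h' * (g.+1 + g)).+1 * B <= n)%N.

Lemma value_lt m u j o : (slot j o * B + offset m u o < n)%N.
Proof.
apply: leq_trans Ln.
have := offset_lt m u o; have := slot_lt j o; nia.
Qed.

Definition config : finType :=
  ('I_L * {ffun 'I_g.+1 -> {ffun 'I_h' -> 'I_L}})%type.

Definition point (x : config) (i : 'I_g.+1 * option 'I_h') : 'I_n :=
  Ordinal (value_lt x.1 (x.2 i.1) i.1 i.2).

Definition points (x : config) : {set 'I_n} := [set point x i | i : _].

Hypothesis h'_gt0 : (0 < h')%N.

(** Free slots stay below [h' * g.+1], with quotient [a] and remainder [j] modulo [g.+1]; the last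
    slots start there, spaced by [h' > 0]. *)
Lemma slot_inj j j' o o' : slot j o = slot j' o' -> (j, o) = (j', o').
Proof.
have lt1 (i : 'I_g.+1) (a : 'I_h') : (a * g.+1 + i < h' * g.+1)%N.
  by have := ltn_ord a; have := ltn_ord i; nia.
case: o o' => [a|] [a'|] /=.
- move=> E; have jj : j = j' :> nat.
    have := congr1 (modn^~ g.+1) E.
    by rewrite !modnMDl !modn_small ?ltn_ord.
  have aa : a = a' :> nat.
    by move: E; rewrite jj => /eqP; rewrite eqn_add2r eqn_pmul2r // => /eqP.
  by rewrite (val_inj jj) (val_inj aa).
- by move=> E; have := lt1 j a; rewrite E ltnNge leq_addr.
- by move=> E; have := lt1 j' a'; rewrite -E ltnNge leq_addr.
move/eqP; rewrite eqn_add2l eqn_pmul2l // => /eqP E.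
congr (_, _); apply: val_inj => /=.
by have := ltn_ord j; have := ltn_ord j'; lia.
Qed.

(** Division by [B] gives the slot as quotient and the offset as remainder. *)
Lemma point_eq (x y : config) i i' : point x i = point y i' ->
  i = i' /\ offset x.1 (x.2 i.1) i.2 = offset y.1 (y.2 i'.1) i'.2.
Proof.
move=> /(congr1 (@nat_of_ord n)) /= E.
have Bgt0 : (0 < B)%N by apply: leq_ltn_trans (offset_lt x.1 (x.2 i.1) i.2).
have S : slot i.1 i.2 = slot i'.1 i'.2.
  have := congr1 (divn^~ B) E.
  by rewrite !divnMDl // !divn_small ?offset_lt // !addn0.
split; first by have := slot_inj S; rewrite -!surjective_pairing.
by apply/eqP; rewrite -(eqn_add2l (slot i.1 i.2 * B)) {2}S E.
Qed.

Lemma point_inj x : injective (point x).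
Proof. by move=> i i' /point_eq []. Qed.

Lemma card_points x : #|points x| = (g.+1 * h'.+1)%N.
Proof.
by rewrite card_imset ?card_prod ?card_option ?card_ord //; apply: point_inj.
Qed.

Lemma point_eqE x y j o : (point x (j, o) == point y (j, o)) =
  (offset x.1 (x.2 j) o == offset y.1 (y.2 j) o).
Proof.
apply/eqP/eqP => [/point_eq [] //|E]; apply: val_inj => /=.
by rewrite E.
Qed.

(** The [h' * j] of the free slots is balanced by the [h' * (g - j)] of the last; the final [h'.+1]
    collects the shifts by one in [elt]. *)
Lemma sum_block x j : (\sum_o elt (point x (j, o)) =
  (\sum_(a < h') a * g.+1 + h' * g.+1 + h' * g) * B + h' * L + x.1 + h'.+1)%N.
Proof.
rewrite /elt; under eq_bigr do rewrite -addn1.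
rewrite big_split /= sum1_card card_option card_ord; congr addn.
rewrite big_option /= big_split /= -big_distrl /= big_split /=.
rewrite sum_nat_const card_ord.
have := sum_offset_le (x.2 j); have := ltn_ord j.
set s := (\sum_i x.2 j i)%N => jg sL.
set A := (\sum_i _)%N.
have E : (h' * j + h' * (g - j) = h' * g)%N by rewrite -mulnDr subnKC.
rewrite -E !mulnDl; lia.
Qed.

(** Each block, once sorted, is a solution, with the same sum for all [j] by [sum_block]; disjoint
    slots make these [g.+1] solutions distinct. *)
Lemma points_not_Bhg x (A : {set 'I_n}) :
  points x \subset A -> ~ is_Bhg h'.+1 g A.
Proof.
move=> xA; pose r := relpre (@elt n) leq.
pose s j := sort r [seq point x (j, o) | o : option 'I_h'].
have ss j : size (s j) == h'.+1.
  by rewrite size_sort size_map -cardT card_option card_ord.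
pose blk j : h'.+1.-tuple 'I_n := Tuple (ss j).
have mem_blk j y : (y \in blk j) = (y \in [seq point x (j, o) | o : option 'I_h']).
  exact: mem_sort.
pose m := (\sum_o elt (point x (ord0, o)))%N.
have summ j : (\sum_(i <- blk j) elt i)%N = m.
  rewrite /m sum_block -(sum_block x j) [LHS](perm_big _ (permEl (perm_sort _ _))).
  by rewrite big_map big_enum.
have blk_inj : injective blk.
  move=> j j' E; have : point x (j, None) \in blk j'.
    by rewrite -E mem_blk; apply: (image_f (fun o => point x (j, o))).
  by rewrite mem_blk => /mapP [o _ /point_eq [[]]].
move=> /(_ m) H; have /H : (h'.+1 <= m <= n * h'.+1)%N.
  have co : #|{: option 'I_h'}| = h'.+1 by rewrite card_option card_ord.
  apply/andP; split; first by rewrite -co -sum1_card leq_sum.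
  by rewrite mulnC -co -sum_nat_const leq_sum // => o _; exact: ltn_ord.
apply/negP; rewrite -ltnNge -[leqLHS](card_ord g.+1) -cardsT.
rewrite -(card_imset _ blk_inj).
apply/subset_leq_card/subsetP => _ /imsetP [j _ ->].
rewrite inE summ eqxx andbT; apply/andP; split.
  rewrite sorted_map; apply: sort_sorted => y z; exact: leq_total.
apply/allP => y; rewrite mem_blk => /mapP [o _ ->].
by apply: (subsetP xA); apply: imset_f.
Qed.

End Configurations.

(** * Estimate of the second moment *)

Section SecondMoment.
Variables (R : realFieldType) (h' L : nat) (p : R).
Hypotheses (h'_gt0 : (0 < h')%N) (p_gt0 : 0 < p) (k_ge1 : 1 <= L%:R * p).

(** Ratio between the probability that the random set contains both blocks and the product of the
    two separate probabilities. *)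
Definition weight (m m' : 'I_L) (u u' : {ffun 'I_h' -> 'I_L}) : R :=
  \prod_o (if offset m u o == offset m' u' o then p^-1 else 1).

(** Split by the agreement set [F]: the empty one gives the main term, a proper nonempty one costs
    [(L p)^-1] to the power [#|F|], at most [1 / (L p)] by [k_ge1], and the full one requires
    [m = m']. *)
Lemma sum_weight_row_le (m m' : 'I_L) (u : {ffun 'I_h' -> 'I_L}) :
  \sum_u' weight m m' u u' <=
    L%:R ^+ h' * (1 + (2 ^ h'.+1)%:R / (L%:R * p)) +
    (m == m')%:R * p^-1 ^+ h'.+1.
Proof.
have L0 : (0 : R) < L%:R by rewrite ltr0n (leq_ltn_trans _ (ltn_ord m)).
set k := L%:R * p; have k0 : 0 < k by apply: mulr_gt0.
have co : #|{: option 'I_h'}| = h'.+1 by rewrite card_option card_ord.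
pose agr u' : {set option 'I_h'} := [set o | offset m u o == offset m' u' o].
have wE u' : weight m m' u u' = p^-1 ^+ #|agr u'|.
  by rewrite -prodr_const [RHS]big_mkcond; apply: eq_bigr => o _; rewrite inE.
rewrite (partition_big agr predT) //=.
apply: (@le_trans _ _ (\sum_(F : {set option 'I_h'})
    (L%:R ^+ h' * ((F == set0)%:R + k^-1) +
     (F == setT)%:R * ((m == m')%:R * p^-1 ^+ h'.+1)))); last first.
  have delta (X : {set option 'I_h'}) : \sum_F (F == X)%:R = 1 :> R.
    by rewrite (bigD1 X) //= eqxx big1 ?addr0 // => F /negPf ->.
  rewrite big_split /= -mulr_sumr big_split /= -mulr_suml !delta mul1r sumr_const.
  by rewrite -cardsT -powersetT card_powerset cardsT co -[k^-1 *+ _]mulr_natl.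
apply: ler_sum => F _.
have -> : \sum_(u' | agr u' == F) weight m m' u u' =
    #|[set u' | agr u' == F]|%:R * p^-1 ^+ #|F|.
  rewrite -sum1_card natr_sum mulr_suml; apply: eq_big => u'; first by rewrite inE.
  by move=> /eqP <-; rewrite wE mul1r.
have := card_agree m m' u F; rewrite -/agr -(ler_nat R) => cF.
have pF : 0 <= p^-1 ^+ #|F| by rewrite exprn_ge0 // invr_ge0 ltW.
apply: le_trans (ler_wpM2r pF cF) _ => {cF}.
have [->|FT] := eqVneq F setT.
  rewrite cardsT co mul1r lerDr mulr_ge0 ?exprn_ge0 ?addr_ge0 ?ler0n //.
  by rewrite invr_ge0 ltW.
rewrite mul0r addr0.
have Fh : (#|F| <= h')%N.
  by rewrite -ltnS -co -cardsT proper_card // properT.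
have -> : (L ^ (h' - #|F|))%:R * p^-1 ^+ #|F| = L%:R ^+ h' * k^-1 ^+ #|F|.
  rewrite natrX invfM exprMn mulrA; congr (_ * _).
  rewrite exprVn -[X in _ = _ ^+ X / _](subnK Fh) exprD.
  by rewrite mulfK // expf_neq0 // gt_eqF.
rewrite ler_wpM2l ?exprn_ge0 ?ler0n //.
have ki : 0 <= k^-1 <= 1 by rewrite invr_ge0 ltW //= invf_le1.
case/andP: ki => ki0 ki1.
have [->|F0] := eqVneq F set0; first by rewrite cards0 expr0 lerDl.
by rewrite add0r -[leRHS]expr1 ler_wiXn2l // card_gt0.
Qed.

Lemma sum_weight_le (m m' : 'I_L) :
  \sum_u \sum_u' weight m m' u u' <=
    L%:R ^+ (2 * h') * (1 + (2 ^ h'.+1)%:R / (L%:R * p) +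
      (m == m')%:R * (L%:R / (L%:R * p) ^+ h'.+1)).
Proof.
have L0 : (0 : R) < L%:R by rewrite ltr0n (leq_ltn_trans _ (ltn_ord m)).
apply: le_trans (ler_sum _ (fun u _ => sum_weight_row_le m m' u)) _.
rewrite sumr_const card_ffun !card_ord -[leLHS]mulr_natl natrX.
suff -> : forall c d : R,
    L%:R ^+ (2 * h') * (c + d * (L%:R / (L%:R * p) ^+ h'.+1)) =
    L%:R ^+ h' * (L%:R ^+ h' * c + d * p^-1 ^+ h'.+1) by [].
move=> c d; rewrite mul2n -addnn exprD exprMn exprVn !exprS.
have := expf_neq0 h' (lt0r_neq0 L0); have := expf_neq0 h' (lt0r_neq0 p_gt0).
move: (p ^+ h') (L%:R ^+ h') => x y x0 y0; field.
by rewrite x0 y0 !gt_eqF.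
Qed.

Lemma sum_weight_ge0 (m m' : 'I_L) : 0 <= \sum_u \sum_u' weight m m' u u'.
Proof.
do 2![apply: sumr_ge0 => ? _]; apply: prodr_ge0 => o _.
by case: ifP; rewrite ?ler01 // invr_ge0 ltW.
Qed.

(** Relative to [e ^+ 2], all pairs [(m, m')] together give at most [a ^+ g.+1], and the diagonal, a
    fraction [1 / L] of the pairs, a further [(a + b) ^+ g.+1 / L]. *)
Lemma Bhg_bound (g n : nat) (mu : {set 'I_n} -> R) (Q : pred {set 'I_n}) :
    let a := 1 + (2 ^ h'.+1)%:R / (L%:R * p) in
    ((h' * (g.+1 + g)).+1 * (h'.+1 * L) <= n)%N ->
    subset_law p mu -> (forall A, Q A -> is_Bhg h'.+1 g A) ->
  \sum_(A | Q A) mu A <=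
    a ^+ g.+1 - 1 + (a + L%:R / (L%:R * p) ^+ h'.+1) ^+ g.+1 / L%:R.
Proof.
move=> a Ln mulaw QB; set b := L%:R / _ ^+ h'.+1.
have Lpos : (0 < L)%N.
  by case: (L) k_ge1 => //; rewrite mul0r ler10.
have L0 : (0 : R) < L%:R by rewrite ltr0n.
have b0 : 0 <= b by rewrite divr_ge0 ?exprn_ge0 ?mulr_ge0 ?ler0n // ltW.
have a0 : 0 <= a by rewrite addr_ge0 // divr_ge0 ?mulr_ge0 ?ler0n // ltW.
have sep A x : Q A -> ~~ (points Ln x \subset A).
  by move=> /QB AB; apply/negP => /(points_not_Bhg h'_gt0); apply.
have := second_moment mulaw sep.
under [X in X ^+ 2]eq_bigr do rewrite card_points //.
rewrite sumr_const card_prod !card_ffun !card_ord.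
set e := (_ *+ _) => H.
have e2 : e ^+ 2 = p ^+ (2 * (g.+1 * h'.+1)) * L%:R ^+ (2 * h') ^+ g.+1 * L%:R ^+ 2.
  have -> : L%:R ^+ (2 * h') ^+ g.+1 = (L%:R ^+ h' ^+ g.+1) ^+ 2 :> R.
    by rewrite -!exprM; congr (_ ^+ _); lia.
  by rewrite /e -[p ^+ _ *+ _]mulr_natl natrM !natrX; rewrite [(2 * _)%N]mulnC;
    rewrite [p ^+ (_ * 2)]exprM; ring.
have e0 : 0 < e ^+ 2 by rewrite e2 !mulr_gt0 ?exprn_gt0.
have pE x y : p ^+ #|points Ln x :|: points Ln y| =
    p ^+ (2 * (g.+1 * h'.+1)) * \prod_j weight x.1 y.1 (x.2 j) (y.2 j).
  rewrite expr_card_union ?gt_eqF //; try exact: point_inj.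
    rewrite card_prod card_option !card_ord; congr (_ * _).
    rewrite /weight pair_bigA /=; apply: eq_bigr => [[j o]] _.
    by rewrite point_eqE.
  by move=> i i' /(point_eq h'_gt0) [].
pose UT := {ffun 'I_g.+1 -> {ffun 'I_h' -> 'I_L}}.
(* For fixed [m] and [m'] the blocks vary independently, so the sum over families of blocks is a
   power. *)
have T : \sum_x \sum_y p ^+ #|points Ln x :|: points Ln y| =
    p ^+ (2 * (g.+1 * h'.+1)) *
      \sum_m \sum_m' (\sum_u \sum_u' weight m m' u u') ^+ g.+1.
  under eq_bigr do under eq_bigr do rewrite pE.
  under eq_bigr do rewrite -mulr_sumr.
  rewrite -mulr_sumr; congr (_ * _).
  rewrite -(pair_bigA _ (fun m (U : UT) =>
    \sum_(y : config h' g L) \prod_j weight m y.1 (U j) (y.2 j))) /=.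
  apply: eq_bigr => m _.
  under eq_bigr => U _ do rewrite -(pair_bigA _ (fun m' (U' : UT) =>
    \prod_j weight m m' (U j) (U' j))) /=.
  rewrite exchange_big /=; apply: eq_bigr => m' _.
  rewrite -[in RHS](card_ord g.+1) -prodr_const bigA_distr_bigA /=.
  by apply: eq_bigr => U _; rewrite bigA_distr_bigA.
have {}T : \sum_x \sum_y p ^+ #|points Ln x :|: points Ln y| <=
    e ^+ 2 * (a ^+ g.+1 + (a + b) ^+ g.+1 / L%:R).
  rewrite T e2 -!mulrA ler_wpM2l ?exprn_ge0 ?(ltW p_gt0) //.
  apply: (@le_trans _ _ (\sum_(m < L) \sum_(m' < L) L%:R ^+ (2 * h') ^+ g.+1 *
      (a ^+ g.+1 + (m == m')%:R * (a + b) ^+ g.+1))).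
    apply: ler_sum => m _; apply: ler_sum => m' _.
    apply: le_trans (lerXn2r _ _ _ (sum_weight_le m m')) _.
    - by rewrite nnegrE sum_weight_ge0.
    - by rewrite nnegrE (le_trans (sum_weight_ge0 m m')) // sum_weight_le.
    rewrite -/a -/b exprMn ler_wpM2l ?exprn_ge0 ?ler0n //.
    case: (m == m'); rewrite ?mul1r ?mul0r ?addr0 // lerDr exprn_ge0 //.
  have -> : \sum_(m < L) \sum_(m' < L) L%:R ^+ (2 * h') ^+ g.+1 *
      (a ^+ g.+1 + (m == m')%:R * (a + b) ^+ g.+1) =
      \sum_(m < L) L%:R ^+ (2 * h') ^+ g.+1 * (L%:R * a ^+ g.+1 + (a + b) ^+ g.+1).
    apply: eq_bigr => m _; rewrite -mulr_sumr big_split /= sumr_const card_ord.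
    rewrite -mulr_suml mulr_natl (bigD1 m) //= eqxx big1 ?addr0 ?mul1r //.
    by move=> i im; rewrite eq_sym (negPf im).
  rewrite sumr_const card_ord -[leLHS]mulr_natl le_eqVlt; apply/orP; left.
  by apply/eqP; field; rewrite gt_eqF.
rewrite -(ler_pM2l e0) mulrC; apply: (le_trans H).
apply: le_trans (lerB T (lexx _)) _.
by rewrite le_eqVlt; apply/orP; left; apply/eqP; ring.
Qed.

End SecondMoment.

(** * The law of the random subset and the asymptotics *)

From mathcomp Require Import all_classical all_reals all_analysis.

Import Order.TTheory GRing.Theory Num.Theory.
Import numFieldNormedType.Exports.

Local Open Scope classical_set_scope.
Local Open Scope ring_scope.

(** [mu A] is the probability of [C = A]; independence enters through [U \subset C], the
    intersection of the events [i \in C] for [i] in [U]. *)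
Lemma law_of_random_subset (d : measure_display) (T : measurableType d)
    (R : realType) (P : probability T R) (n : nat) (p : R)
    (C : T -> {set 'I_n}) :
    random_subset P p C ->
  exists2 mu : {set 'I_n} -> R, subset_law p mu &
    forall Q : pred {set 'I_n},
      P [set t | Q (C t)] = (\sum_(A | Q A) mu A)%:E.
Proof.
move=> [mC PC indepC].
pose E (A : {set 'I_n}) := [set t | C t = A].
have mE A : measurable (E A).
  have -> : E A = \bigcap_(i in [set: 'I_n])
      (if i \in A then [set t | i \in C t] else ~` [set t | i \in C t]).
    apply/seteqP; split=> [t <- i _ /=|t H]; first by case: ifPn => //= /negP.
    apply/setP => i; have := H i I; case: ifP => _ /=; first by move=> ->.
    by move/negP/negPf.
  apply: fin_bigcap_measurable => // i _.
  by case: ifP => _ //; apply: measurableC.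
have PE (Q : pred {set 'I_n}) :
    P [set t | Q (C t)] = (\sum_(A | Q A) fine (P (E A)))%:E.
  have -> : [set t | Q (C t)] = \bigcup_(A in [set` enum Q]) E A.
    apply/seteqP; split=> [t Qt|t [A]] /=; last by rewrite mem_enum => QA ->.
    by exists (C t) => //=; rewrite mem_enum.
  rewrite measure_fin_bigcup //; last first.
    by move=> A A' _ _ [t []]; rewrite /E /= => -> ->.
  rewrite -fsbig_seq ?enum_uniq // big_enum /= -sumEFin.
  by apply: eq_bigr => A _; rewrite fineK ?fin_num_measure.
exists (fun A => fine (P (E A))) => //; split=> [A|U].
  by apply: fine_ge0; apply: measure_ge0.
apply: EFin_inj; rewrite -(PE (fun A => U \subset A)).
have -> : [set t | U \subset C t] = \bigcap_(i in [set` U]) [set t | i \in C t].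
  apply/seteqP; split=> [t /= /fintype.subsetP H i|t H] /=; first exact: H.
  by apply/fintype.subsetP => i; apply: H.
rewrite (indepC U) (eq_bigr (fun=> p%:E)) => [|i _]; last exact: PC.
by rewrite prodEFin prodr_const.
Qed.

(** * Estimates around the threshold *)

Lemma exprn_1D_le (R : realFieldType) (x : R) (m : nat) :
  0 <= x <= 1 -> (1 + x) ^+ m <= 1 + 3 ^+ m * x.
Proof.
move=> /andP [x0 x1]; elim: m => [|m IH]; first by rewrite !expr0 mul1r lerDl.
have c1 : 1 <= 3 ^+ m :> R by rewrite exprn_ege1 // ler1n.
rewrite exprS; apply: le_trans (ler_wpM2l _ IH) _; first by rewrite addr_ge0.
rewrite exprS; move: (3 ^+ m) c1 => c c1.
(* The terms [x], [c * x] and [c * x * x] are each at most [c * x], so the constant triples. *)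
have : x <= c * x by rewrite ler_peMl.
have : c * x * x <= c * x by rewrite ler_piMr // mulr_ge0 // (le_trans ler01).
lra.
Qed.

Lemma exprDn_le (R : realFieldType) (x y : R) (m : nat) :
  0 <= x -> 0 <= y -> (x + y) ^+ m <= 2 ^+ m * (x ^+ m + y ^+ m).
Proof.
wlog xy : x y / x <= y.
  move=> H x0 y0; have [/H|/ltW/H] := leP x y; first exact.
  by rewrite addrC [y ^+ m + _]addrC; apply.
move=> x0 y0; apply: (@le_trans _ _ ((2 * y) ^+ m)).
  by apply: lerXn2r; rewrite ?nnegrE ?addr_ge0 ?mulr_ge0 //; lra.
by rewrite exprMn ler_wpM2l ?exprn_ge0 // lerDr exprn_ge0.
Qed.

Section Threshold.
Variables (R : realType) (h g : nat).
Hypothesis h_gt0 : (0 < h)%N.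

Let theta : R := g%:R / (h%:R * (g%:R + 1)).

(** On exponents this reads [theta * r <= t - 1], the last clause of [admissible]. *)
Lemma threshold_expr_le (n t r : nat) :
    (0 < n)%N -> admissible h g t r ->
  (n%:R `^ theta) ^+ r <= n%:R ^+ t.-1 :> R.
Proof.
move=> n0 /and3P [t1 tr rg].
rewrite -powR_mulrn ?powR_ge0 // -powRrM -[leRHS]powR_mulrn ?ler0n //.
apply: ler_powR; first by rewrite ler1n.
rewrite /theta mulrAC ler_pdivrMr; last first.
  by rewrite mulr_gt0 ?ltr0n // addr_gt0 ?ltr0n.
by rewrite natr1 -!natrM ler_nat mulnA mulnC.
Qed.

Lemma threshold_expr (n : nat) :
  (n%:R `^ theta) ^+ (h * g.+1) = n%:R ^+ g :> R.
Proof.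
rewrite -powR_mulrn ?powR_ge0 // -powRrM -[RHS]powR_mulrn ?ler0n //.
congr (_ `^ _); rewrite /theta natrM -natr1 mulfVK //.
by rewrite mulf_neq0 ?pnatr_eq0 -?lt0n // natr1 pnatr_eq0.
Qed.

Lemma threshold_ge1 (n : nat) : (0 < n)%N -> 1 <= n%:R `^ theta :> R.
Proof.
move=> n0; rewrite -[leLHS](powRr0 n%:R); apply: ler_powR; first by rewrite ler1n.
by rewrite divr_ge0 ?mulr_ge0 ?addr_ge0 ?ler0n.
Qed.

(** Up to constants the left side is [k^r n^(1 - t)], where [k^r <= e^r n^(t - 1)] and [e^r <= e] as
    [r >= 1]. *)
Lemma pattern_term_le (c n t r : nat) (k e : R) :
    (0 < n)%N -> admissible h g t r -> 0 <= k <= e * n%:R `^ theta ->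
    0 <= e <= 1 ->
  (c * (n * h).+1 * n ^ (r - t))%:R * (k / n%:R) ^+ r <= (c * (2 * h))%:R * e.
Proof.
move=> n0 adm /andP [k0 kle] /andP [e0 e1].
have N0 : (0 : R) < n%:R by rewrite ltr0n.
have kr : k ^+ r <= e * n%:R ^+ t.-1.
  apply: (@le_trans _ _ ((e * n%:R `^ theta) ^+ r)).
    by apply: lerXn2r; rewrite ?nnegrE ?mulr_ge0 ?powR_ge0.
  rewrite exprMn ler_pM ?exprn_ge0 ?powR_ge0 ?threshold_expr_le //.
  rewrite -[leRHS]expr1 ler_wiXn2l //.
  by have /and3P [t1 tr _] := adm; apply: leq_trans tr; apply: ltnW.
have /and3P [t1 tr _] := adm.
have nh : ((n * h).+1%:R : R) <= (2 * h)%:R * n%:R.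
  by rewrite -natrM ler_nat; nia.
rewrite !natrM -!mulrA ler_wpM2l ?ler0n // exprMn exprVn.
apply: (@le_trans _ _ ((2 * h)%:R * n%:R * (n%:R ^+ (r - t) *
   (e * n%:R ^+ t.-1 / n%:R ^+ r)))).
  apply: ler_pM nh _; rewrite ?ler0n ?mulr_ge0 ?divr_ge0 ?exprn_ge0 ?ler0n //.
  by rewrite natrX ler_wpM2l ?exprn_ge0 ?ler0n // ler_wpM2r // invr_ge0 exprn_ge0.
have -> : n%:R ^+ r = n%:R * n%:R ^+ (r - t) * n%:R ^+ t.-1 :> R.
  by rewrite -exprS -exprD; congr (_ ^+ _); lia.
rewrite le_eqVlt; apply/orP; left; apply/eqP.
have := expf_neq0 (r - t) (lt0r_neq0 N0); have := expf_neq0 t.-1 (lt0r_neq0 N0).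
move: (n%:R ^+ (r - t)) (n%:R ^+ t.-1) => x y y0 x0; rewrite natrM; field.
by rewrite x0 y0 gt_eqF.
Qed.

End Threshold.

(** Configurations need room [q * L], so [L = n %/ q] is the largest choice and at least
    [n / (2 q)]. The three error terms [x], [1 / L] and [b ^+ g.+1 / L] are each at most [delta]. *)
Lemma Bhg_bound_above_threshold (R : realType) (h' g n : nat) (k e : R)
    (mu : {set 'I_n} -> R) (Q : pred {set 'I_n}) :
    let q := ((h' * (g.+1 + g)).+1 * h'.+1)%N in
    let delta := 2 ^+ h'.+1 * ((2 * q)%:R * e) in
    (0 < h')%N -> (q <= n)%N -> 0 < e -> delta <= 1 -> 1 <= e * n%:R ->
    n%:R `^ (g%:R / (h'.+1%:R * (g%:R + 1))) <= e * k ->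
    subset_law (k / n%:R) mu -> (forall A, Q A -> is_Bhg h'.+1 g A) ->
  \sum_(A | Q A) mu A <= (3 ^+ g.+1 + 2 ^+ g.+1 * (2 ^+ g.+1 + 1)) * delta.
Proof.
move=> q delta h'0 qn e0 delta1 en kge mulaw QB.
have n0 : (0 < n)%N by apply: leq_trans qn.
have N0 : (0 : R) < n%:R by rewrite ltr0n.
have th1 := threshold_ge1 R h'.+1 g n0.
set L := (n %/ q)%N.
have L0 : (0 < L)%N by rewrite divn_gt0.
have LR0 : (0 : R) < L%:R by rewrite ltr0n.
have nL : (n%:R : R) <= (2 * q)%:R * L%:R.
  rewrite -natrM ler_nat.
  have : (n < L.+1 * q)%N by apply: ltn_ceil.
  by nia.
have Lq : ((h' * (g.+1 + g)).+1 * (h'.+1 * L) <= n)%N.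
  by rewrite mulnA mulnC; apply: leq_trunc_div.
have k0 : 0 < k by rewrite -(pmulr_rgt0 _ e0) (lt_le_trans ltr01) // (le_trans th1).
have p0 : 0 < k / n%:R by rewrite divr_gt0.
set kap := L%:R * (k / n%:R).
have kap0 : 0 < kap by rewrite mulr_gt0.
set c := (2 * q)%:R * e.
have c0 : 0 < c by rewrite mulr_gt0 ?ltr0n.
have cdelta : c <= delta by rewrite ler_peMl ?(ltW c0) // exprn_ege1 // ler1n.
have c1 : c <= 1 by apply: le_trans delta1.
have delta0 : 0 <= delta by rewrite (le_trans _ cdelta) // ltW.
have thc : n%:R `^ (g%:R / (h'.+1%:R * (g%:R + 1))) <= c * kap.
  apply: (le_trans kge).
  have -> : c * kap = e * k * ((2 * q)%:R * L%:R / n%:R).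
    by rewrite /c /kap; field; rewrite gt_eqF.
  by rewrite ler_peMr ?mulr_ge0 ?(ltW e0) ?(ltW k0) // ler_pdivlMr // mul1r.
have ckap : 1 <= c * kap by apply: le_trans thc.
have kap1 : 1 <= kap by rewrite (le_trans ckap) // ler_piMl // ltW.
apply: (le_trans (Bhg_bound h'0 p0 kap1 Lq mulaw QB)).
rewrite -/kap natrX; set b := _ / kap ^+ _.
have b0 : 0 <= b by rewrite divr_ge0 ?exprn_ge0 // ltW.
set x := 2 ^+ _ / kap.
have xd : 0 <= x <= delta.
  rewrite divr_ge0 ?exprn_ge0 ?(ltW kap0) //= /delta ler_pM2l ?exprn_gt0 //.
  by rewrite -[leLHS]mul1r ler_pdivrMr.
case/andP: xd => x0 xd.
have x1 : 0 <= x <= 1 by rewrite x0 (le_trans xd).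
have Li : L%:R^-1 <= delta.
  apply: le_trans cdelta; rewrite -[leLHS]mul1r ler_pdivrMr //.
  apply: (le_trans en); by rewrite /c mulrAC [leLHS]mulrC ler_wpM2r // ltW.
(* The exponent of the threshold is decisive here: its power [h'.+1 * g.+1] is [n ^+ g], which
   dominates [L ^+ g], and the threshold is at most [c * kap]. *)
have bL : b ^+ g.+1 / L%:R <= delta.
  have -> : b ^+ g.+1 / L%:R = L%:R ^+ g / kap ^+ (h'.+1 * g.+1).
    rewrite /b expr_div_n -exprM exprS mulrAC; congr (_ / _).
    by rewrite mulrAC mulfV ?mul1r ?gt_eqF.
  rewrite ler_pdivrMr ?exprn_gt0 //.
  apply: (@le_trans _ _ (n%:R ^+ g)).
    by apply: lerXn2r; rewrite ?nnegrE ?ler0n // ler_nat leq_div.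
  rewrite -(threshold_expr R g (ltn0Sn h')).
  apply: (@le_trans _ _ ((c * kap) ^+ (h'.+1 * g.+1))).
    by apply: lerXn2r; rewrite ?nnegrE ?powR_ge0 // (le_trans ler01).
  rewrite exprMn ler_wpM2r ?exprn_ge0 ?(ltW kap0) //.
  apply: le_trans cdelta; rewrite -[leRHS]expr1 ler_wiXn2l // ltW //.
have aG : (1 + x) ^+ g.+1 <= 1 + 3 ^+ g.+1 * delta.
  by apply: le_trans (exprn_1D_le _ x1) _; rewrite lerD2l ler_wpM2l ?exprn_ge0.
have aL : (1 + x) ^+ g.+1 / L%:R <= 2 ^+ g.+1 * delta.
  apply: ler_pM; rewrite ?exprn_ge0 ?invr_ge0 ?ler0n ?addr_ge0 //.
  by apply: lerXn2r; rewrite ?nnegrE ?addr_ge0 //; lra.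
(* [3 ^+ g.+1] pays for [a ^+ g.+1 - 1], the outer [2 ^+ g.+1] for splitting [(a + b) ^+ g.+1]; here
   [a = 1 + x]. *)
rewrite mulrDl; apply: lerD; first by rewrite lerBlDl.
apply: (@le_trans _ _ (2 ^+ g.+1 * ((1 + x) ^+ g.+1 / L%:R + b ^+ g.+1 / L%:R))).
  rewrite -mulrDl mulrA ler_wpM2r ?invr_ge0 ?ler0n // exprDn_le // addr_ge0 //.
by rewrite -mulrA ler_wpM2l ?exprn_ge0 // mulrDl mul1r lerD.
Qed.

Theorem theorem3p4 (R : realType) (h g : nat) (hh : (2 <= h)%N) (hg : (1 <= g)%N)
    (k : nat -> R) (hk : forall n : nat, 0 <= k n <= n%:R)
    (d : nat -> measure_display) (T : forall n : nat, measurableType (d n))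
    (P : forall n : nat, probability (T n) R)
    (C : forall n : nat, T n -> {set 'I_n})
    (hC : forall n : nat, random_subset (P n) (k n / n%:R) (C n)) :
  let threshold : nat -> R :=
    fun n => n%:R `^ (g%:R / (h%:R * (g%:R + 1))) in
  ((k : nat -> R^o) =o_\oo (threshold : nat -> R^o) ->
    P n [set t | is_Bhg h g (C n t)] @[n --> \oo] --> 1%E) /\
  ((threshold : nat -> R^o) =o_\oo (k : nat -> R^o) ->
    P n [set t | is_Bhg h g (C n t)] @[n --> \oo] --> 0%E).
Proof.
move=> threshold.
have h0 : (0 < h)%N by apply: ltnW.
have thr0 n : 0 <= threshold n by apply: powR_ge0.
have k0 n : 0 <= k n by have /andP [] := hk n.
pose mu n := sval (cid2 (law_of_random_subset (hC n))).
have mulaw n : subset_law (k n / n%:R) (mu n).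
  by rewrite /mu; case: (cid2 _).
have muP n (Q : pred {set 'I_n}) :
    P n [set t | Q (C n t)] = (\sum_(A | Q A) mu n A)%:E.
  by rewrite /mu; case: (cid2 _) => m /= _ ->.
pose Bhg n : pred {set 'I_n} := fun A => `[< is_Bhg h g A >].
pose s n := \sum_(A | Bhg n A) mu n A.
have PE : (fun n => P n [set t | is_Bhg h g (C n t)]) = EFin \o s.
  apply/funext => n /=; rewrite -muP; congr (P n _).
  by apply/seteqP; split=> t /= /asboolP.
have s0 n : 0 <= s n by apply: sumr_ge0 => A _; case: (mulaw n).
have s1 n : s n = 1 - \sum_(A | ~~ Bhg n A) mu n A.
  apply/eqP; rewrite eq_sym subr_eq; apply/eqP.
  have [_ /(_ finset.set0)] := mulaw n; rewrite cards0 expr0 => <-.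
  rewrite (bigID (Bhg n)) /=; congr (_ + _);
    by apply: eq_bigl => A; rewrite finset.sub0set.
rewrite PE; split=> /eqoP small; (apply: cvg_EFin; first by near=> n);
  apply/cvgrPdist_le => eta eta0.
- pose K : R := \sum_(t < g.+2) \sum_(r < (g.+1 * h).+1 | admissible h g t r)
    (#|{: 'M['I_h.+1]_(t, r)}| * (2 * h))%:R.
  have K0 : 0 <= K by do 2![apply: sumr_ge0 => ? _].
  (* The bound 1 serves [pattern_term_le], and [K + 1] keeps the denominator positive. *)
  pose e := Num.min 1 (eta / (K + 1)).
  have e0 : 0 < e by rewrite lt_min ltr01 divr_gt0 // ltr_wpDl.
  have e1 : e <= 1 by rewrite ge_min lexx.
  have Ke : K * e <= eta.
    apply: (@le_trans _ _ ((K + 1) * (eta / (K + 1)))).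
      by apply: ler_pM => //; rewrite ?(ltW e0) ?lerDl ?ge_min ?lexx ?orbT.
    by rewrite mulrC divfK // gt_eqF // ltr_wpDl.
  near=> n.
  have n0 : (0 < n)%N by near: n; exists 1%N.
  have kn : `|k n| <= e * `|threshold n| by near: n; exact: small.
  rewrite !ger0_norm ?thr0 ?k0 // in kn.
  rewrite /= s1 opprB addrC subrK ger0_norm; last first.
    by apply: sumr_ge0 => A _; case: (mulaw n).
  apply: le_trans Ke.
  apply: (le_trans (not_Bhg_bound h0 hg _ (mulaw n) _)).
  - by rewrite divr_ge0.
  - by move=> A /asboolPn.
  rewrite mulr_suml; apply: ler_sum => t _; rewrite mulr_suml.
  apply: ler_sum => r tr; apply: (pattern_term_le h0 _ n0 tr).
    by rewrite k0 kn.
  by rewrite ltW.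
case: h hh h0 @threshold thr0 small @Bhg @s PE s0 s1 => // h' hh _ threshold.
move=> thr0 small Bhg s _ s0 _.
pose q := ((h' * (g.+1 + g)).+1 * h'.+1)%N.
pose M : R := 3 ^+ g.+1 + 2 ^+ g.+1 * (2 ^+ g.+1 + 1).
have M0 : 0 < M by rewrite ltr_pwDl ?exprn_gt0 // mulr_ge0 ?addr_ge0 ?exprn_ge0.
pose c : R := 2 ^+ h'.+1 * (2 * q)%:R.
have c0 : 0 < c by rewrite mulr_gt0 ?exprn_gt0 ?ltr0n.
(* With [delta = c * e], the first bound gives [delta <= 1] and the second [M * delta <= eta]. *)
pose e := Num.min c^-1 (eta / (M * c)).
have e0 : 0 < e by rewrite lt_min invr_gt0 c0 divr_gt0 ?mulr_gt0.
near=> n.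
have n0 : (0 < n)%N by near: n; exists 1%N.
have kn : `|threshold n| <= e * `|k n| by near: n; exact: small.
rewrite !ger0_norm ?thr0 ?k0 // in kn.
rewrite /= sub0r normrN ger0_norm //.
apply: (le_trans (Bhg_bound_above_threshold (Q := Bhg n) hh _ e0 _ _ kn
  (mulaw n) _)) => //.
- by near: n; exists q.
- by rewrite mulrA -ler_pdivlMl // mulr1 ge_min lexx.
- rewrite -ler_pdivrMl // mulr1; near: n; exact: nbhs_infty_ger.
- by move=> A /asboolP.
rewrite -/M -/q [X in M * X]mulrA -/c mulrA -ler_pdivlMl ?mulr_gt0 // [leRHS]mulrC.
by rewrite ge_min lexx orbT.
Unshelve. all: by end_near. Qed.
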